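(* Let $k$ be a field of prime characteristic $p$, let $G$ be a finite group and let $b$ be a block of $G$ (a primitive idempotent of $\mathrm{Z}(kG)$). Let $\mathscr{A}(b)$ be the $G$-poset of $b$-Brauer pairs $(Q,e)$ with $Q$ nontrivial elementary abelian, and let $\mathscr{K}(b)$ be the commuting poset of $b$. Then the maps $$\Phi:\mathscr{A}(b)\to\mathscr{K}(b),\quad (Q,e)\mapsto (c(Q),e),$$ where $c(Q)$ is the set of subgroups of order $p$ of $Q$, and $$\Psi:\mathscr{K}(b)\to\mathscr{A}(b),\quad (\kappa,e)\mapsto(\Pi\kappa,e),$$ where $\Pi\kappa$ is the product in $G$ of all subgroups belonging to $\kappa$, are inverse $G$-homotopy equivalences.
   Context: Let $k$ be a field of prime characteristic $p$ and $G$ a finite group. A block of $G$ is a primitive idempotent $b$ of $\mathrm{Z}(kG)$ (similarly for subgroups of $G$). For a $p$-subgroup $Q$ of $G$, $(kG)^Q$ is the subalgebra of elements of $kG$ fixed by conjugation by $Q$, and the Brauer homomorphism $\mathrm{Br}_Q:(kG)^Q\to k\mathrm{C}_G(Q)$ is the surjective algebra homomorphism $\sum_{x\in G}\alpha_x x\mapsto\sum_{x\in \mathrm{C}_G(Q)}\alpha_x x$. A $b$-Brauer pair is a pair $(Q,e)$ consisting of a $p$-subgroup $Q$ of $G$ and a block $e$ of $\mathrm{C}_G(Q)$ with $\mathrm{Br}_Q(b)e\neq 0$. The set of $b$-Brauer pairs carries the standard (Alperin--Broué) partial order: it is the transitive closure of the relation $(Q,e)\trianglelefteq(R,f)$, which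 means that $Q$ is normal in $R$, $e$ is fixed under conjugation by $R$, and $\mathrm{Br}_R(e)f=f$. Given a Brauer pair $(R,f)$ and $Q\leq R$, there is a unique block $e$ of $\mathrm{C}_G(Q)$ with $(Q,e)\leq(R,f)$. $G$ acts on this poset by conjugation, making it a $G$-poset (a poset on which $G$ acts by order-preserving maps). $\mathscr{A}(b)$ is the $G$-subposet of all $b$-Brauer pairs $(Q,e)$ such that $Q$ is nontrivial and elementary abelian. Two subgroups $R,R'$ of $G$ commute if $[R,R']=1$. For a nonempty set $\kappa$ of pairwise commuting subgroups of $G$, $\Pi\kappa$ denotes the product in $G$ of all subgroups belonging to $\kappa$, which is a subgroup of $G$. For an abelian subgroup $Q$ of $G$, $c(Q)$ denotes the set of subgroups of order $p$ of $Q$. The commuting poset $\mathscr{K}(b)$ of $b$ is the $G$-poset (with $G$ acting by conjugation) whose elements are pairs $(\kappa,e)$, where $\kappa$ is a nonempty set of pairwise commuting subgroups of order $p$ of $G$ and $e$ is a block of $\mathrm{C}_G(\Pi\kappa)$ such that $(\Pi\kappa,e)$ is a $b$-Brauer pair; the order is: $(\lambda,f)\leq(\kappa,e)$ if $\lambda\subseteq\kappa$ and $(\Pi\lambda,f)\leq(\Pi\kappa,e)$ as Brauer pairs. For a $G$-poset $\mathfrak{X}$, $\Delta\mathfrak{X}$ is the $G$-simplicial complex whose $n$-simplices ($n\geq 0$) are the chains of $n$ proper inclusions in $\mathfrak{X}$, and $|\Delta\mathfrak{X}|$ is its geometric realization, a $G$-space. Two $G$-equivariant continuous maps $f:X\to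 Y$, $g:Y\to X$ of $G$-spaces are inverse $G$-homotopy equivalences if there are $G$-equivariant homotopies $h:I\times X\to X$ and $h':I\times Y\to Y$ with $h(0,-)=\mathrm{Id}_X$, $h(1,-)=g\circ f$, $h'(0,-)=\mathrm{Id}_Y$, $h'(1,-)=f\circ g$, where $I=[0,1]$ has the trivial $G$-action. $G$-equivariant order-preserving maps between $G$-posets $\mathfrak{X}$ and $\mathfrak{Y}$ are inverse $G$-homotopy equivalences if the maps they induce between $|\Delta\mathfrak{X}|$ and $|\Delta\mathfrak{Y}|$ are. *)

(* Defs.v *)
From HB Require Import structures.
From mathcomp Require Import all_boot all_order all_algebra all_fingroup.
From mathcomp Require Import cyclic pgroup abelian boolp.
From Stdlib Require Import Relation_Operators.

Set Implicit Arguments.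
Unset Strict Implicit.
Unset Printing Implicit Defensive.

Import Order.TTheory GRing.Theory Num.Theory.
Local Open Scope ring_scope.

Section GroupAlgebra.
Variables (k : fieldType) (G : finGroupType).

(* A record rather than a bare {ffun G -> k}, which already carries the
   pointwise ring structure. *)
Record galg := GAlg { gcoef :> {ffun G -> k} }.

HB.instance Definition _ := [isNew for gcoef].
HB.instance Definition _ := [Choice of galg by <:].

Implicit Types (a b c : galg) (g h x y : G).

Lemma galgP a b : (forall x, a x = b x) <-> a = b.
Proof. by split=> [ab|->//]; apply: val_inj; apply/ffunP. Qed.

Definition galg_add a b := GAlg [ffun x => a x + b x].
Definition galg_opp a := GAlg [ffun x => - a x].
Definition galg_scale (l : k) a := GAlg [ffun x => l * a x].

Fact galg_addA : associative galg_add.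
Proof. by move=> a b c; apply/galgP => x; rewrite !ffunE addrA. Qed.
Fact galg_addC : commutative galg_add.
Proof. by move=> a b; apply/galgP => x; rewrite !ffunE addrC. Qed.
Fact galg_add0 : left_id (GAlg [ffun=> 0]) galg_add.
Proof. by move=> a; apply/galgP => x; rewrite !ffunE add0r. Qed.
Fact galg_addN : left_inverse (GAlg [ffun=> 0]) galg_opp galg_add.
Proof. by move=> a; apply/galgP => x; rewrite !ffunE addNr. Qed.

HB.instance Definition _ := GRing.isZmodule.Build galg
  galg_addA galg_addC galg_add0 galg_addN.

Lemma galgDE a b x : (a + b) x = a x + b x. Proof. by rewrite ffunE. Qed.
Lemma galg0E x : (0 : galg) x = 0. Proof. by rewrite ffunE. Qed.
Lemma galgNE a x : (- a) x = - a x. Proof. by rewrite ffunE. Qed.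

Fact galg_scaleA l m a : galg_scale l (galg_scale m a) = galg_scale (l * m) a.
Proof. by apply/galgP => x; rewrite !ffunE mulrA. Qed.
Fact galg_scale1 : left_id 1 galg_scale.
Proof. by move=> a; apply/galgP => x; rewrite !ffunE mul1r. Qed.
Fact galg_scaleDr : right_distributive galg_scale +%R.
Proof. by move=> l a b; apply/galgP => x; rewrite !ffunE mulrDr. Qed.
Fact galg_scaleDl a : {morph galg_scale^~ a : l m / l + m}.
Proof. by move=> l m; apply/galgP => x; rewrite !ffunE mulrDl. Qed.

HB.instance Definition _ := GRing.Zmodule_isLmodule.Build k galg
  galg_scaleA galg_scale1 galg_scaleDr galg_scaleDl.

Lemma galgZE (l : k) a x : (l *: a) x = l * a x. Proof. by rewrite ffunE. Qed.

Definition gelt g := GAlg [ffun x => (x == g)%:R].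
Definition galg_mul a b := GAlg [ffun x => \sum_y a y * b (y^-1 * x)%g].

Fact galg_mulA : associative galg_mul.
Proof.
move=> a b c; apply/galgP => x; rewrite !ffunE.
transitivity (\sum_y \sum_z a z * b (z^-1 * y)%g * c (y^-1 * x)%g); last first.
  by apply: eq_bigr => y _; rewrite ffunE mulr_suml.
rewrite exchange_big /=; apply: eq_bigr => z _.
rewrite ffunE mulr_sumr (reindex_inj (mulgI z^-1%g)) /=.
by apply: eq_bigr => y _; rewrite invMg invgK -!mulgA mulKVg !mulrA.
Qed.

Fact galg_mul1 : left_id (gelt 1) galg_mul.
Proof.
move=> a; apply/galgP => x; rewrite ffunE (bigD1 1%g) //= ffunE eqxx mul1r.
rewrite invg1 mul1g big1 ?addr0 // => y /negPf yn1.
by rewrite ffunE yn1 mul0r.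
Qed.

Fact galg_mulr1 : right_id (gelt 1) galg_mul.
Proof.
move=> a; apply/galgP => x; rewrite ffunE (bigD1 x) //= ffunE mulVg eqxx mulr1.
rewrite big1 ?addr0 // => y yx; rewrite ffunE.
case: eqP => [|_]; last by rewrite mulr0.
by move/(canRL (mulKg _)); rewrite invgK mulg1 => xy; rewrite xy eqxx in yx.
Qed.

Fact galg_mulDl : left_distributive galg_mul +%R.
Proof.
move=> a b c; apply/galgP => x; rewrite galgDE !ffunE -big_split.
by apply: eq_bigr => y _; rewrite galgDE mulrDl.
Qed.

Fact galg_mulDr : right_distributive galg_mul +%R.
Proof.
move=> a b c; apply/galgP => x; rewrite galgDE !ffunE -big_split.
by apply: eq_bigr => y _; rewrite galgDE mulrDr.
Qed.

Fact galg_1neq0 : gelt 1 != 0.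
Proof.
apply/eqP => /galgP/(_ 1%g); rewrite galg0E ffunE eqxx => /eqP.
by rewrite oner_eq0.
Qed.

HB.instance Definition _ := GRing.Zmodule_isNzRing.Build galg
  galg_mulA galg_mul1 galg_mulr1 galg_mulDl galg_mulDr galg_1neq0.

Fact galg_scaleAl (l : k) a b : l *: (a * b) = (l *: a) * b.
Proof.
apply/galgP => x; rewrite galgZE !ffunE mulr_sumr.
by apply: eq_bigr => y _; rewrite galgZE mulrA.
Qed.

HB.instance Definition _ := GRing.Lmodule_isLalgebra.Build k galg galg_scaleAl.

Fact galg_scaleAr (l : k) a b : l *: (a * b) = a * (l *: b).
Proof.
apply/galgP => x; rewrite galgZE !ffunE mulr_sumr.
by apply: eq_bigr => y _; rewrite galgZE mulrCA.
Qed.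

HB.instance Definition _ := GRing.Lalgebra_isAlgebra.Build k galg galg_scaleAr.

Lemma galgME a b x : (a * b) x = \sum_y a y * b (y^-1 * x)%g.
Proof. by rewrite ffunE. Qed.

(* kH inside kG: the elements supported on H. *)
Definition subgalg (H : {set G}) : {pred galg} :=
  [pred a : galg | [forall (x | x \notin H), a x == 0]].

Lemma subgalgP (H : {set G}) a :
  reflect (forall x, x \notin H -> a x = 0) (a \in subgalg H).
Proof.
by apply: (iffP forall_inP) => aH x /aH; [move/eqP | move=> ->].
Qed.

(* a lies in Z(kH). *)
Definition central (H : {set G}) a :=
  a \in subgalg H /\ {in subgalg H, forall c, a * c = c * a}.

(* e is a primitive idempotent of Z(kH). *)
Record is_block (H : {set G}) e : Prop := IsBlock {
  block_central : central H e;
  block_idem : e * e = e;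
  block_neq0 : e != 0;
  block_primitive : forall f f', central H f -> central H f' ->
    f * f = f -> f' * f' = f' -> f * f' = 0 -> e = f + f' -> f = 0 \/ f' = 0
}.

(* sum_x a_x x |-> sum_x a_x x^g, with x^g = g^-1 x g. *)
Definition gconj a g := GAlg [ffun x => a (x ^ g^-1)%g].

(* The formula of the Brauer homomorphism Br_Q, totalized to all of kG; it is
   multiplicative only on the Q-fixed elements, to which it is applied. *)
Definition brauer (Q : {set G}) a :=
  GAlg [ffun x => if x \in 'C(Q)%g then a x else 0].

Lemma gconj1 a : gconj a 1 = a.
Proof. by apply/galgP => x; rewrite ffunE invg1 conjg1. Qed.

Lemma gconjM a g h : gconj a (g * h) = gconj (gconj a g) h.
Proof. by apply/galgP => x; rewrite !ffunE invMg conjgM. Qed.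

Lemma gconj_inj g : injective (gconj^~ g).
Proof.
move=> a b ab; rewrite -[a]gconj1 -[b]gconj1 -(mulgV g) !gconjM.
by rewrite /= in ab; rewrite ab.
Qed.

Lemma gconj0 g : gconj 0 g = 0.
Proof. by apply/galgP => x; rewrite ffunE !galg0E. Qed.

Lemma gconjD a b g : gconj (a + b) g = gconj a g + gconj b g.
Proof. by apply/galgP => x; rewrite ffunE !galgDE !ffunE. Qed.

Lemma gconj_mul a b g : gconj (a * b) g = gconj a g * gconj b g.
Proof.
apply/galgP => x; rewrite ffunE !galgME (reindex_inj (conjg_inj g^-1%g)) /=.
by apply: eq_bigr => y _; rewrite !ffunE conjMg conjVg.
Qed.

Lemma subgalgJ (H : {set G}) a g :
  (gconj a g \in subgalg (H :^ g)%g) = (a \in subgalg H).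
Proof.
apply/subgalgP/subgalgP => aH x xH; last by rewrite ffunE aH // -mem_conjg.
by have := aH (x ^ g)%g; rewrite memJ_conjg ffunE conjgK; apply.
Qed.

Lemma centralJ (H : {set G}) a g :
  central H a -> central (H :^ g)%g (gconj a g).
Proof.
move=> [aH aC]; split=> [|c]; rewrite ?subgalgJ //.
rewrite -[c]gconj1 -(mulVg g) gconjM subgalgJ => cH.
by rewrite -!gconj_mul aC.
Qed.

Lemma is_blockJ (H : {set G}) e g : is_block H e -> is_block (H :^ g)%g (gconj e g).
Proof.
case=> eC eI e0 eP; split; first exact: centralJ.
- by rewrite -gconj_mul eI.
- by apply: contra_neq e0 => e0; apply: (@gconj_inj g); rewrite /= gconj0.
move=> f f' fC f'C fI f'I ff' eff'.
have J := gconj_mul _ _ g^-1%g.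
have cJ c : central (H :^ g)%g c -> central H (gconj c g^-1%g).
  by move/(centralJ g^-1%g); rewrite conjsgK.
have J0 c : gconj c g^-1%g = 0 -> c = 0.
  by move=> c0; apply: (@gconj_inj g^-1%g); rewrite /= gconj0.
have [||||/J0|/J0] := eP _ _ (cJ _ fC) (cJ _ f'C); [| | | |by left|by right].
- by rewrite -J fI.
- by rewrite -J f'I.
- by rewrite -J ff' gconj0.
- by rewrite -gconjD -eff' -gconjM mulgV gconj1.
Qed.

Lemma brauerJ (Q : {set G}) a g :
  brauer (Q :^ g)%g (gconj a g) = gconj (brauer Q a) g.
Proof. by apply/galgP => x; rewrite !ffunE centJ mem_conjg. Qed.

Lemma brauer_id (Q : {set G}) a : a \in subgalg 'C(Q)%g -> brauer Q a = a.
Proof.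
by move/subgalgP => aQ; apply/galgP => x; rewrite ffunE; case: ifPn => // /aQ.
Qed.

Lemma mul_gelt a g x : (a * gelt g) x = a (x * g^-1)%g.
Proof.
rewrite galgME (bigD1 (x * g^-1)%g) //= ffunE invMg invgK mulgKV eqxx mulr1.
rewrite big1 ?addr0 // => y yx; rewrite ffunE; case: eqP => [|_].
  by move/(canRL (mulKVg _)) => xy; rewrite xy mulgK eqxx in yx.
by rewrite mulr0.
Qed.

Lemma gelt_mul a g x : (gelt g * a) x = a (g^-1 * x)%g.
Proof.
rewrite galgME (bigD1 g) //= ffunE eqxx mul1r big1 ?addr0 // => y /negPf yg.
by rewrite ffunE yg mul0r.
Qed.

Lemma central_fixed a g : central [set: G]%G a -> gconj a g = a.
Proof.
case=> _ /(_ (gelt g)) ag; apply/galgP => y; rewrite ffunE.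
have /ag/galgP/(_ (g * y)%g) : gelt g \in subgalg [set: G]%G.
  by apply/subgalgP => x; rewrite inE.
by rewrite mul_gelt gelt_mul mulKg conjgE invgK mulgA.
Qed.

Lemma block_mul_eq (H : {set G}) e f :
  is_block H e -> is_block H f -> e * f = f -> e = f.
Proof.
move=> [[eH eC] eI e0 eP] [[fH fC] fI f0 _] ef.
have fe : f * e = f by rewrite -eC.
have efC : central H (e - f).
  split=> [|c cH]; last by rewrite mulrBl mulrBr eC ?fC.
  apply/subgalgP => x xH; rewrite galgDE galgNE.
  by rewrite (subgalgP _ _ eH) ?(subgalgP _ _ fH) ?subrr.
have [|||/eqP|/eqP] := eP f (e - f) (conj fH fC) efC fI.
- by rewrite mulrBr !mulrBl eI fe ef fI subrr subr0.
- by rewrite mulrBr fe fI subrr.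
- by rewrite addrC subrK.
- by rewrite (negPf f0).
- by rewrite subr_eq0 => /eqP.
Qed.

End GroupAlgebra.

Record block (k : fieldType) (G : finGroupType) (H : {group G}) := Block {
  block_val :> galg k G;
  block_valP : is_block H block_val
}.

Section GPosets.
Variable G : finGroupType.

(* G acts on the right, as is the convention for {action G &-> _}. *)
Record gposet := GPoset {
  gposet_disp : Order.disp_t;
  gposet_sort :> porderType gposet_disp;
  gposet_act : {action G &-> gposet_sort};
  gposet_act_le : forall g, {homo gposet_act^~ g : x y / (x <= y)%O}
}.

End GPosets.

Section BrauerPairs.
Variables (k : fieldType) (G : finGroupType) (p : nat).
Variable b : block k [set: G]%G.

Record is_brauer_pair (Q : {group G}) (e : galg k G) : Prop := IsBrauerPair {
  brauer_pair_pgroup : (p.-group Q)%g;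
  brauer_pair_block : is_block 'C(Q)%g e;
  brauer_pair_nonzero : brauer Q b * e != 0
}.

Record brauer_pair := BrauerPair {
  bp_val :> {group G} * galg k G;
  bp_valP : `[< is_brauer_pair bp_val.1 bp_val.2 >]
}.

HB.instance Definition _ := [isSub for bp_val].
HB.instance Definition _ := [Choice of brauer_pair by <:].

Implicit Types x y z : brauer_pair.

Lemma brauer_pairP x : is_brauer_pair x.1 x.2.
Proof. exact/asboolP/bp_valP. Qed.

(* (Q, e) normal in (R, f), with x = (Q, e) and y = (R, f). *)
Definition bp_normal x y :=
  [/\ (x.1 <| y.1)%g, {in y.1, forall g, gconj x.2 g = x.2}
    & brauer y.1 x.2 * y.2 = y.2].

(* The transitive closure is reflexive because bp_normal is. *)
Definition bp_le x y := `[< clos_trans brauer_pair bp_normal x y >].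

Lemma bp_normal_refl x : bp_normal x x.
Proof.
have [_ [[eC eZ] eI _ _] _] := brauer_pairP x; split=> //.
  move=> g gQ; apply/galgP => y; rewrite ffunE.
  have [yC|yC] := boolP (y \in 'C(x.1)%g).
    congr (x.2 _); apply/conjg_fixP/commgP.
    by apply: commuteV; exact: (centP yC).
  rewrite (subgalgP _ _ eC y) // (subgalgP _ _ eC) //.
  by rewrite -mem_conjg -centJ conjGid.
by rewrite brauer_id.
Qed.

Lemma bp_sub x y : bp_le x y -> x.1 \subset y.1.
Proof.
move/asboolP; elim=> {x y} [x y [/andP[xy _] _ _] //|x y z _ xy _ yz].
exact: subset_trans xy yz.
Qed.

Fact bp_le_refl : reflexive bp_le.
Proof. by move=> x; apply/asboolP/t_step/bp_normal_refl. Qed.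

Fact bp_le_trans : transitive bp_le.
Proof. by move=> y x z /asboolP xy /asboolP yz; apply/asboolP; apply: t_trans yz. Qed.

Lemma bp_le_eq x y : bp_le x y -> x.1 = y.1 -> x = y.
Proof.
move/asboolP; elim=> {x y} [x y [_ _ ef] xy|x y z xy IHx yz IHy xz].
  have [_ be _] := brauer_pairP x; have [eC _] := block_central be.
  have [_ bf _] := brauer_pairP y.
  apply: val_inj; rewrite (surjective_pairing (val x)) (surjective_pairing (val y)).
  rewrite /= xy; congr pair; rewrite -xy in bf ef.
  by apply: block_mul_eq be bf _; rewrite -[RHS]ef brauer_id.
have xy1 : x.1 = y.1.
  apply/val_inj/eqP; rewrite eqEsubset bp_sub; last exact/asboolP.
  by rewrite xz bp_sub //; exact/asboolP.
by rewrite IHx // IHy // -xy1.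
Qed.

Fact bp_le_anti : antisymmetric bp_le.
Proof.
move=> x y /andP[xy yx]; apply: bp_le_eq (xy) _.
by apply/val_inj/eqP; rewrite eqEsubset !bp_sub.
Qed.

Fact bp_display : Order.disp_t. Proof. exact: Order.Disp tt tt. Qed.

HB.instance Definition _ := Order.Le_isPOrder.Build bp_display brauer_pair
  bp_le_refl bp_le_anti bp_le_trans.

Lemma is_brauer_pairJ (Q : {group G}) e g :
  is_brauer_pair Q e -> is_brauer_pair (Q :^ g)%G (gconj e g).
Proof.
case=> pQ be bne; split; rewrite /= ?pgroupJ //.
  by rewrite centJ; exact: is_blockJ.
rewrite -(central_fixed g (block_central (block_valP b))) brauerJ -gconj_mul.
by apply: contra_neq bne => be0; apply: (@gconj_inj _ _ g); rewrite /= gconj0.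
Qed.

Definition bp_conj x g :=
  @BrauerPair ((x.1 :^ g)%G, gconj x.2 g) (asboolT (is_brauer_pairJ g (brauer_pairP x))).

Lemma bp_conj1 : bp_conj^~ 1%g =1 id.
Proof.
move=> x; apply: val_inj => /=; rewrite gconj1 [RHS]surjective_pairing.
by congr pair; apply: val_inj; rewrite /= conjsg1.
Qed.

Lemma bp_conjM x : act_morph bp_conj x.
Proof.
move=> g h; apply: val_inj => /=; rewrite gconjM.
by congr pair; apply: val_inj; rewrite /= conjsgM.
Qed.

Definition bp_act := TotalAction bp_conj1 bp_conjM.

Lemma bp_conj_le g : {homo bp_conj^~ g : x y / (x <= y)%O}.
Proof.
move=> x y /asboolP xy; apply/asboolP; elim: xy => {x y} [x y|x y z _ xy _].
  case=> xy xf xyf; apply: t_step; split=> /=; first by rewrite normalJ.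
    move=> h; rewrite mem_conjg => hy; rewrite -gconjM.
    rewrite -[X in _ = gconj X _](xf _ hy) -gconjM.
    by rewrite conjgE invgK !mulgA mulgKV.
  by rewrite brauerJ -gconj_mul xyf.
exact: t_trans.
Qed.

(* The b-Brauer pairs (Q, e) with Q nontrivial elementary abelian, with the
   order induced from all b-Brauer pairs. *)
Record elab_pair := ElabPair {
  elab_val :> brauer_pair;
  elab_valP : (elab_val.1 :!=: 1)%g && (p.-abelem elab_val.1)%g
}.

HB.instance Definition _ := [isSub for elab_val].
HB.instance Definition _ := [Choice of elab_pair by <:].
HB.instance Definition _ :=
  [SubChoice_isSubPOrder of elab_pair by <: with bp_display].

Lemma elabJ (x : elab_pair) g :
  ((bp_conj x g).1 :!=: 1)%g && (p.-abelem (bp_conj x g).1)%g.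
Proof.
have /andP[x1 xp] := elab_valP x; rewrite /= abelemJ xp andbT.
by apply: contra x1 => /eqP x1; rewrite -(conjsgK g x.1) x1 conjs1g.
Qed.

Definition elab_conj (x : elab_pair) g := ElabPair (elabJ x g).

Lemma elab_conj1 : elab_conj^~ 1%g =1 id.
Proof. by move=> x; apply: val_inj; exact: bp_conj1. Qed.

Lemma elab_conjM (x : elab_pair) : act_morph elab_conj x.
Proof. by move=> g h; apply: val_inj; exact: bp_conjM. Qed.

Lemma elab_conj_le g : {homo elab_conj^~ g : x y / (x <= y)%O}.
Proof. by move=> x y; exact: bp_conj_le. Qed.

Definition elab_poset : gposet G :=
  @GPoset G bp_display elab_pair (TotalAction elab_conj1 elab_conjM) elab_conj_le.

(* In Group_scope \prod is the iterated join; pi_groupE identifies it with the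
   product of subsets of G when the members of kappa commute pairwise. *)
Definition pi_group (kappa : {set {group G}}) : {group G} :=
  (\prod_(H in kappa) H)%G.

Definition pairwise_commuting (kappa : {set {group G}}) :=
  {in kappa &, forall H K : {group G}, [~: H, K]%g = 1%g :> {set G}}.

Lemma pi_group_sub (kappa : {set {group G}}) (H : {group G}) :
  H \in kappa -> H \subset pi_group kappa.
Proof. by move=> Hk; rewrite bigprodGE sub_gen // (bigcup_sup H). Qed.

Lemma pi_group_min (kappa : {set {group G}}) (K : {group G}) :
  (forall H : {group G}, H \in kappa -> H \subset K) -> pi_group kappa \subset K.
Proof. by move=> kK; rewrite bigprodGE gen_subG; apply/bigcupsP. Qed.

Lemma pi_groupE (kappa : {set {group G}}) : pairwise_commuting kappa ->
  pi_group kappa = (\prod_(H in kappa) H)%g :> {set G}.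
Proof.
rewrite /pi_group -big_filter -[in RHS]big_filter => kC.
set r := [seq H <- _ | _].
have: {in r &, forall H K : {group G}, [~: H, K]%g = 1%g :> {set G}}.
  by move=> H K; rewrite !mem_filter => /andP[Hk _] /andP[Kk _]; exact: kC.
elim: {kC}r => [|H r IHr] rC; first by rewrite !big_nil.
rewrite !big_cons -IHr; last first.
  by move=> K L Kr Lr; apply: rC; rewrite inE ?Kr ?Lr orbT.
apply: comm_joingE; apply: centC; rewrite centsC bigprodGE gen_subG.
elim: r rC {IHr} => [|K r IHr] rC; first by rewrite big_nil sub0set.
rewrite big_cons subUset; apply/andP; split.
  by rewrite centsC; apply/commG1P/rC; rewrite !inE eqxx ?orbT.
apply: IHr => L M Lr Mr; apply: rC; rewrite !inE.
  by move: Lr; rewrite inE => /orP[->|->]; rewrite ?orbT.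
by move: Mr; rewrite inE => /orP[->|->]; rewrite ?orbT.
Qed.

Lemma pi_groupJ (kappa : {set {group G}}) g :
  pi_group [set (H :^ g)%G | H in kappa] = (pi_group kappa :^ g)%G.
Proof.
apply/val_inj/eqP; rewrite eqEsubset /=; apply/andP; split.
  apply: (@pi_group_min _ (pi_group kappa :^ g)) => _ /imsetP[H Hk ->].
  by rewrite conjSg pi_group_sub.
rewrite sub_conjg.
apply: (@pi_group_min _ (pi_group [set (H :^ g)%G | H in kappa] :^ g^-1)) => H Hk.
by rewrite -sub_conjg; apply: (@pi_group_sub _ (H :^ g)%G); apply: imset_f.
Qed.

Lemma pi_group_abelian (kappa : {set {group G}}) :
  pairwise_commuting kappa -> abelian (pi_group kappa).
Proof.
move=> kC; apply: pi_group_min => H Hk; rewrite centsC.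
by apply: pi_group_min => K Kk; apply/commG1P/kC.
Qed.

Record is_comm_pair (kappa : {set {group G}}) (e : galg k G) : Prop := IsCommPair {
  comm_pair_neq0 : kappa != set0;
  comm_pair_order : {in kappa, forall H : {group G}, #|H| = p};
  comm_pair_comm : pairwise_commuting kappa;
  comm_pair_brauer : is_brauer_pair (pi_group kappa) e
}.

Record comm_pair := CommPair {
  cp_val :> {set {group G}} * galg k G;
  cp_valP : `[< is_comm_pair cp_val.1 cp_val.2 >]
}.

HB.instance Definition _ := [isSub for cp_val].
HB.instance Definition _ := [Choice of comm_pair by <:].

Lemma comm_pairP (x : comm_pair) : is_comm_pair x.1 x.2.
Proof. exact/asboolP/cp_valP. Qed.

Definition cp_brauer (x : comm_pair) : brauer_pair :=
  @BrauerPair (pi_group x.1, x.2) (asboolT (comm_pair_brauer (comm_pairP x))).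

Definition cp_le (x y : comm_pair) :=
  (x.1 \subset y.1) && (cp_brauer x <= cp_brauer y)%O.

Fact cp_le_refl : reflexive cp_le.
Proof. by move=> x; rewrite /cp_le lexx subxx. Qed.

Fact cp_le_trans : transitive cp_le.
Proof.
move=> y x z /andP[xy xy'] /andP[yz yz'].
by rewrite /cp_le (subset_trans xy yz) (le_trans xy' yz').
Qed.

Fact cp_le_anti : antisymmetric cp_le.
Proof.
move=> x y /andP[/andP[xy xy'] /andP[yx yx']].
have /(congr1 (fun z : brauer_pair => z.2)) /= exy : cp_brauer x = cp_brauer y.
  by apply: le_anti; rewrite xy' yx'.
apply: val_inj; rewrite /= [LHS]surjective_pairing [RHS]surjective_pairing exy.
by congr pair; apply/eqP; rewrite eqEsubset xy.
Qed.

Fact cp_display : Order.disp_t. Proof. exact: Order.Disp tt tt. Qed.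

HB.instance Definition _ := Order.Le_isPOrder.Build cp_display comm_pair
  cp_le_refl cp_le_anti cp_le_trans.

Lemma is_comm_pairJ (kappa : {set {group G}}) e g : is_comm_pair kappa e ->
  is_comm_pair [set (H :^ g)%G | H in kappa] (gconj e g).
Proof.
case=> k0 kp kc kb; split.
- by rewrite imset_eq0.
- by move=> _ /imsetP[H Hk ->]; rewrite /= cardJg kp.
- move=> _ _ /imsetP[H Hk ->] /imsetP[K Kk ->] /=.
  by rewrite -conjsRg kc // conjs1g.
- by rewrite pi_groupJ; exact: is_brauer_pairJ.
Qed.

Definition cp_conj (x : comm_pair) g : comm_pair :=
  @CommPair ([set (H :^ g)%G | H in x.1], gconj x.2 g)
    (asboolT (is_comm_pairJ g (comm_pairP x))).

Lemma cp_conj1 : cp_conj^~ 1%g =1 id.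
Proof.
move=> x; apply: val_inj => /=; rewrite gconj1 [RHS]surjective_pairing.
congr pair; rewrite -[RHS]imset_id; apply: eq_imset => H.
by apply: val_inj; rewrite /= conjsg1.
Qed.

Lemma cp_conjM (x : comm_pair) : act_morph cp_conj x.
Proof.
move=> g h; apply: val_inj => /=; rewrite gconjM.
congr pair; rewrite -imset_comp; apply: eq_imset => H.
by apply: val_inj; rewrite /= conjsgM.
Qed.

Lemma cp_conj_le g : {homo cp_conj^~ g : x y / (x <= y)%O}.
Proof.
have J (z : comm_pair) : cp_brauer (cp_conj z g) = bp_conj (cp_brauer z) g.
  by apply: val_inj; rewrite /= pi_groupJ.
move=> x y /andP[xy xy']; apply/andP; split; first exact: imsetS.
by rewrite !J; exact: bp_conj_le.
Qed.

Definition comm_poset : gposet G :=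
  @GPoset G cp_display comm_pair (TotalAction cp_conj1 cp_conjM) cp_conj_le.

Definition subgroups_of_order_p (Q : {group G}) : {set {group G}} :=
  [set H : {group G} | (H \subset Q) && (#|H| == p)].

Lemma pi_group_order_p (Q : {group G}) :
  (p.-abelem Q)%g -> pi_group (subgroups_of_order_p Q) = Q.
Proof.
move=> pQ; apply/val_inj/eqP; rewrite eqEsubset /=; apply/andP; split.
  by apply: pi_group_min => H; rewrite inE => /andP[].
apply/subsetP => x xQ; have [-> // | x1] := eqVneq x 1%g.
have := @pi_group_sub (subgroups_of_order_p Q) <[x]>%G; rewrite inE cycle_subG xQ.
by rewrite /= -orderE (abelem_order_p pQ xQ x1) eqxx cycle_subG => ->.
Qed.

Lemma elab_is_comm_pair (x : elab_pair) :
  is_comm_pair (subgroups_of_order_p (elab_val x).1) (elab_val x).2.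
Proof.
have /andP[x1 xp] := elab_valP x; have bx := brauer_pairP x.
split; rewrite ?pi_group_order_p //.
- apply: contra x1 => /eqP c0.
  by rewrite -(pi_group_order_p xp) c0 /pi_group big_set0.
- by move=> H; rewrite inE => /andP[_ /eqP].
- move=> H K; rewrite !inE => /andP[HQ _] /andP[KQ _]; apply/commG1P.
  exact: (sub_abelian_cent2 (abelem_abelian xp)).
Qed.

Lemma comm_is_elab (charkp : p \in [pchar k]) (x : comm_pair) :
  ((cp_brauer x).1 :!=: 1)%g && (p.-abelem (cp_brauer x).1)%g.
Proof.
have [/set0Pn[H Hx] xp xC bx] := comm_pairP x.
have p_pr : prime p by case/andP: charkp.
apply/andP; split=> /=.
  apply: contraL (prime_gt1 p_pr) => /eqP x1; rewrite -leqNgt -(xp _ Hx).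
  by have := subset_leq_card (pi_group_sub Hx); rewrite x1 cards1.
have pX := brauer_pair_pgroup bx; have aX := pi_group_abelian xC.
apply: abelemS (Ohm1_abelem pX aX); apply: pi_group_min => K Kx.
apply/subsetP => y yK; rewrite /= (OhmE 1 pX) mem_gen // !inE.
rewrite (subsetP (pi_group_sub Kx)) //= expn1 -order_dvdn -(xp _ Kx).
exact: order_dvdG.
Qed.

Definition Phi (x : elab_poset) : comm_poset :=
  @CommPair (subgroups_of_order_p (elab_val x).1, (elab_val x).2)
    (asboolT (elab_is_comm_pair x)).

(* The characteristic is needed to know that p is prime: for p = 1 the product
   of kappa would be trivial. *)
Definition Psi (charkp : p \in [pchar k]) (x : comm_poset) : elab_poset :=
  @ElabPair (cp_brauer x) (comm_is_elab charkp x).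

End BrauerPairs.

From mathcomp Require Import classical_sets functions cardinality fsbigop.
From mathcomp Require Import reals topology normedtype.
Import numFieldNormedType.Exports.

Lemma ptws_continuous (W T : topologicalType) (Y : Type) (F : W -> {ptws Y -> T}) :
  (forall y, continuous (fun w => F w y)) -> continuous F.
Proof.
move=> Fc w; apply/cvg_sup.
move=> y; move: w; apply/(@continuousP _ (initial_topology (fun g : Y -> T => g y))).
move=> A [B oB <-]; have /continuousP/(_ B oB) := Fc y; exact.
Qed.

Lemma ptws_eval_continuous (T : topologicalType) (X : choiceType) (x : X) :
  continuous (fun t : {ptws X -> T} => t x).
Proof. exact: (@proj_continuous X (fun=> T) x). Qed.

Section Realization.
Local Open Scope classical_set_scope.
Variable R : realType.

(* t gives the barycentric coordinates of a point of the closed simplex with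
   vertices s. *)
Definition in_simplex (X : choiceType) (s : seq X) (t : X -> R) :=
  [/\ forall x, 0 <= t x, forall x, x \notin s -> t x = 0
    & \sum_(x <- s) t x = 1].

(* |Delta X|: the simplices of Delta X are the finite chains x_0 < ... < x_n. *)
Record realization d (X : porderType d) := Realization {
  bary :> X -> R;
  baryP : exists s : seq X, sorted <%O s /\ in_simplex s bary
}.

HB.instance Definition _ d (X : porderType d) :=
  gen_eqMixin (realization X).
HB.instance Definition _ d (X : porderType d) :=
  gen_choiceMixin (realization X).

Lemma realizationP d (X : porderType d) (t u : realization X) :
  (forall x, t x = u x) -> t = u.
Proof.
case: t u => t tP [u uP] /= /funext tu; subst u.
by congr Realization; exact: Prop_irrelevance.
Qed.

Section Topology.
Variables (d : Order.disp_t) (X : porderType d).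

Definition closed_simplex (s : seq X) : set (realization X) :=
  [set t | in_simplex s t].

(* The coherent (weak) topology: U is open when its trace on every closed
   simplex is relatively open, the latter having its Euclidean topology, which
   is that of pointwise convergence of barycentric coordinates. *)
Definition realization_open (U : set (realization X)) :=
  forall s : seq X, sorted <%O s -> exists V : set {ptws X -> R},
    open V /\ U `&` closed_simplex s =
              (@bary d X) @^-1` V `&` closed_simplex s.

Fact realization_openT : realization_open [set: realization X].
Proof. by move=> s _; exists setT; split; [exact: openT|]. Qed.

Fact realization_openI : setI_closed realization_open.
Proof.
move=> U U' oU oU' s ss; have [[V [oV UV]] [V' [oV' UV']]] := (oU s ss, oU' s ss).
exists (V `&` V'); split; first exact: openI.
by rewrite setIIl UV UV' -setIIl.
Qed.

Fact realization_open_bigU (I : Type) (U : I -> set (realization X)) :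
  (forall i, realization_open (U i)) -> realization_open (\bigcup_i U i).
Proof.
move=> oU s ss; have /choice[V UV] : forall i, exists V : set {ptws X -> R},
    open V /\ U i `&` closed_simplex s =
              (@bary d X) @^-1` V `&` closed_simplex s.
  by move=> i; exact: oU.
exists (\bigcup_i V i); split; first by apply: bigcup_open => i _; case: (UV i).
rewrite preimage_bigcup !setI_bigcupl.
by apply: eq_bigcupr => i _; case: (UV i).
Qed.

HB.instance Definition _ := isOpenTopological.Build (realization X)
  realization_openT realization_openI realization_open_bigU.

Lemma realization_openE (U : set (realization X)) : open U = realization_open U.
Proof. by []. Qed.

End Topology.

Section Map.
Variables (d d' : Order.disp_t) (X : porderType d) (Y : porderType d').
Variables (f : X -> Y) (f_le : {homo f : x y / (x <= y)%O}).

(* The affine extension of f; the sum has finite support for t in |Delta X|. *)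
Definition push (t : X -> R) (y : Y) : R := \sum_(x \in f @^-1` [set y]) t x.

Lemma pushE (s : seq X) (t : X -> R) y : uniq s -> in_simplex s t ->
  push t y = \sum_(x <- s | f x == y) t x.
Proof.
move=> us [_ ts _]; rewrite bigfs //; last by move=> x _; exact: ts.
by apply: eq_fsbigl; apply/seteqP; split=> x /= /eqP.
Qed.

Lemma sorted_image (s : seq X) :
  sorted <%O s -> sorted <%O (undup [seq f x | x <- s]).
Proof.
rewrite !lt_sorted_uniq_le undup_uniq => /andP[_ ss] /=.
apply: subseq_sorted (undup_subseq _) _; first exact: le_trans.
exact: homo_sorted ss.
Qed.

Lemma push_simplex (s : seq X) (t : X -> R) : uniq s -> in_simplex s t ->
  in_simplex (undup [seq f x | x <- s]) (push t).
Proof.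
move=> us ts; have [t0 tN t1] := ts; split=> [y|y|].
- by rewrite (pushE _ us ts) sumr_ge0.
- rewrite mem_undup (pushE _ us ts) => ys; rewrite big1_seq // => x.
  by case/andP=> /eqP fxy xs; rewrite -fxy map_f in ys.
rewrite -t1; under eq_bigr do rewrite (pushE _ us ts).
rewrite (exchange_big_dep xpredT) //=.
apply: eq_big_seq => x xs; rewrite big_mkcond (bigD1_seq (f x)) ?undup_uniq //=; last first.
  by rewrite mem_undup map_f.
by rewrite eqxx big1 ?addr0 // => y /negPf yfx; rewrite eq_sym yfx.
Qed.

Fact push_realization (t : realization X) :
  exists s : seq Y, sorted <%O s /\ in_simplex s (push t).
Proof.
have [s [ss st]] := baryP t; exists (undup [seq f x | x <- s]).
by split; [exact: sorted_image | exact: push_simplex (lt_sorted_uniq ss) st].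
Qed.

Definition realize (t : realization X) : realization Y :=
  Realization (push_realization t).

Lemma realize_continuous : continuous realize.
Proof.
apply/continuousP => U; rewrite !realization_openE => oU s ss.
have us := lt_sorted_uniq ss.
have [V [oV UV]] := oU _ (sorted_image ss).
pose F (t : {ptws X -> R}) : {ptws Y -> R} :=
  fun y => \sum_(x <- s | f x == y) t x.
have Fc : continuous F.
  apply: ptws_continuous => y t.
  apply: (@cvg_big R X +%R 0 (fun x => f x == y) (@add_continuous R)
    {ptws X -> R} (nbhs t) s (fun x u => u x)) => x _.
  exact: ptws_eval_continuous.
exists (F @^-1` V); split; first by move/continuousP: Fc; apply.
have mapF (t : realization X) : in_simplex s t -> realize t = F t :> (Y -> R).
  by move=> st; apply/funext => y; exact: pushE.
have UVE (t : realization X) : in_simplex s t -> U (realize t) = V (F t).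
  move=> st; have ft : closed_simplex (undup [seq f x | x <- s]) (realize t).
    exact: push_simplex.
  have UVt : (U (realize t) /\ closed_simplex (undup [seq f x | x <- s]) (realize t))
      = (V (F t) /\ closed_simplex (undup [seq f x | x <- s]) (realize t)).
    rewrite -mapF //.
    exact: (congr1 (fun W : set (realization Y) => W (realize t)) UV).
  apply/propext; split=> h.
    by have : V (F t) /\ closed_simplex (undup [seq f x | x <- s]) (realize t);
      [rewrite -UVt | case].
  by have : U (realize t) /\ closed_simplex (undup [seq f x | x <- s]) (realize t);
    [rewrite UVt | case].
by apply/seteqP; split=> t [Ut st]; split=> //; move: Ut; rewrite /preimage /= UVE.
Qed.

End Map.

Lemma realize_id d (X : porderType d) (le_id : {homo id : x y / (x <= y)%O})
  (t : realization X) : realize le_id t = t.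
Proof.
have [s [ss st]] := baryP t; have us := lt_sorted_uniq ss.
apply: realizationP => x; rewrite /= (pushE _ _ us st).
have [_ t0 _] := st; have [xs|xs] := boolP (x \in s).
  by rewrite big_mkcond (bigD1_seq x) //= eqxx big1 ?addr0 // => y /negPf ->.
rewrite t0 // big1_seq // => y /andP[/eqP-> xs'].
by rewrite xs' in xs.
Qed.

Lemma realize_comp d d' d2 (X : porderType d) (Y : porderType d')
    (Z : porderType d2) (f : X -> Y) (g : Y -> Z) (h : X -> Z)
    (f_le : {homo f : x y / (x <= y)%O}) (g_le : {homo g : x y / (x <= y)%O})
    (h_le : {homo h : x y / (x <= y)%O}) (t : realization X) :
  (forall x, h x = g (f x)) -> realize h_le t = realize g_le (realize f_le t).
Proof.
move=> hgf; have [s [ss st]] := baryP t; have us := lt_sorted_uniq ss.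
apply: realizationP => z; rewrite /= (pushE _ _ us st).
rewrite (pushE _ _ (undup_uniq _) (push_simplex f us st)).
under [RHS]eq_bigr do rewrite (pushE _ _ us st).
rewrite (exchange_big_dep (fun x => h x == z)) /=; last first.
  by move=> y x /eqP<- /eqP<-; rewrite hgf.
rewrite big_seq_cond [RHS]big_seq_cond; apply: eq_bigr => x /andP[xs /eqP hx].
rewrite big_mkcond (bigD1_seq (f x)) ?undup_uniq ?mem_undup ?map_f //=.
rewrite -hgf hx !eqxx big1 ?addr0 // => y /negPf yfx.
by rewrite eq_sym in yfx; rewrite yfx andbF.
Qed.

End Realization.

Section GSpaces.
Variable G : finGroupType.

Lemma total_actM (T : Type) (to : {action G &-> T}) x : act_morph to x.
Proof. by move=> g h; case: to => act [inj toM]; rewrite /= toM ?inE. Qed.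

Lemma total_act1 (T : Type) (to : {action G &-> T}) x : to x 1%g = x.
Proof.
have inj : left_injective to by case: to => ? [].
by apply: (inj 1%g); rewrite /= -total_actM mulg1.
Qed.

Record gspace := GSpace {
  gspace_sort :> topologicalType;
  gspace_act : {action G &-> gspace_sort};
  gspace_act_continuous : forall g, continuous (gspace_act^~ g)
}.

Definition equivariant (X Y : Type) (aX : {action G &-> X})
    (aY : {action G &-> Y}) (f : X -> Y) :=
  forall x g, f (aX x g) = aY (f x) g.

Section Realization.
Variables (R : realType) (X : gposet G).

Definition realization_act (t : realization R X) (g : G) : realization R X :=
  realize (@gposet_act_le G X g) t.

Fact realization_act1 : realization_act^~ 1%g =1 id.
Proof.
have le_id : {homo (@id X) : x y / (x <= y)%O} by [].
move=> t; rewrite -[RHS](realize_id le_id) -[in LHS](realize_id le_id t).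
by apply/esym/realize_comp => x; rewrite total_act1.
Qed.

Fact realization_actM t : act_morph realization_act t.
Proof. by move=> g h; apply: realize_comp => x; exact: total_actM. Qed.

Definition order_complex : gspace :=
  @GSpace (realization R X) (TotalAction realization_act1 realization_actM)
    (fun g => @realize_continuous R _ _ X X _ (@gposet_act_le G X g)).

End Realization.

Section Homotopy.
Variable R : realType.

(* h is total on R * X, but only its restriction to [0, 1] * X matters. *)
Definition G_homotopic (X Y : gspace) (f g : X -> Y) :=
  exists h : R * X -> Y,
  [/\ {within `[0, 1]%classic `*` [set: X], continuous h}%classic,
      forall s x a, 0 <= s <= 1 ->
        h (s, gspace_act X x a) = gspace_act Y (h (s, x)) a,
      forall x, h (0, x) = f x
    & forall x, h (1, x) = g x].

Definition inverse_G_homotopy_equivalences (X Y : gspace)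
    (f : X -> Y) (g : Y -> X) :=
  [/\ continuous f /\ equivariant (gspace_act X) (gspace_act Y) f,
      continuous g /\ equivariant (gspace_act Y) (gspace_act X) g,
      G_homotopic id (g \o f)
    & G_homotopic id (f \o g)].

(* The induced maps on realizations depend on monotonicity, which is therefore
   asserted first. *)
Definition inverse_G_poset_equivalences (X Y : gposet G)
    (f : X -> Y) (g : Y -> X) :=
  exists (f_le : {homo f : x y / (x <= y)%O})
         (g_le : {homo g : x y / (x <= y)%O}),
  [/\ equivariant (gposet_act X) (gposet_act Y) f,
      equivariant (gposet_act Y) (gposet_act X) g
    & @inverse_G_homotopy_equivalences (order_complex R X) (order_complex R Y)
        (realize f_le) (realize g_le)].

End Homotopy.

End GSpaces.

(* Main.v *)
Require Import Defs.
From mathcomp Require Import all_boot all_order all_algebra all_fingroup reals.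
From mathcomp Require Import boolp classical_sets functions fsbigop.
From mathcomp Require Import topology normedtype.
From mathcomp Require Import lra.

(** The maps between the two posets form a Galois connection: the product of all subgroups of order p of an elementary abelian group Q
is Q, so Psi o Phi is the identity, while every set kappa of commuting
subgroups of order p is contained in the set of all subgroups of order p of its
product, so (kappa, e) <= Phi (Psi (kappa, e)) ([PhiK], [le_Phi_Psi]).  Neither
map changes the Brauer pair underlying a point ([cp_brauer_Phi]), which reduces
these facts and the monotonicity of both maps to statements on subgroups of
order p.  What remains is the equivariant order homotopy theorem
([order_homotopy]): if f <= g are equivariant monotone maps X -> Y between
G-posets, their realizations are G-homotopic.

The straight-line homotopy from f to g leaves the order complex: for x < y the
points g x and f y need not be comparable.  One goes through the prism
X x {false < true} instead.  At time r, a point t of the realization of X,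
supported on a chain x_0 < ... < x_n, is lifted to the prism by leaving the
lower 1 - r of its mass on the bottom copy of X and moving the upper r of its
mass to the top copy.  The vertex x_i at which the cut falls may appear on both
levels, and the support

  (x_0, false) < ... < (x_i, false) < (x_i, true) < ... < (x_n, true)

is again a chain ([prism_bary_simplex]).  The lift is the inclusion of the
bottom copy at time 0, of the top copy at time 1, and commutes with order
automorphisms.  Composing it with the realization of the monotone map
(x, false) |-> f x, (x, true) |-> g x gives the homotopy.

The lift has to be continuous on the product of R with a realization, which
carries the weak topology.  A map out of such a product is continuous as soon
as it is continuous on the products of R with closed simplices, because R is
locally compact ([cylinder_continuous]).  On such a product the lift is given
by a continuous formula with values in finitely many closed simplices of the
prism, and there the weak topology agrees with pointwise convergence of
barycentric coordinates ([near_simplex]). *)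

Set Implicit Arguments.
Unset Strict Implicit.
Unset Printing Implicit Defensive.
Import Order.TTheory GRing.Theory Num.Theory numFieldNormedType.Exports.
Local Open Scope classical_set_scope.
Local Open Scope ring_scope.

(** * The weak topology on a realization *)

Section Coherent.
Variables (R : realType) (d : Order.disp_t) (X : porderType d).
Implicit Types (s : seq X) (t : realization R X) (U : set (realization R X)).

Lemma simplex_closed s : closed [set u : {ptws X -> R} | in_simplex s u].
Proof.
have -> : [set u : {ptws X -> R} | in_simplex s u] =
    (\bigcap_x [set u : {ptws X -> R} | 0 <= u x]) `&`
    (\bigcap_(x in [set x | x \notin s]) [set u : {ptws X -> R} | u x = 0]) `&`
    [set u : {ptws X -> R} | \sum_(x <- s) u x = 1].
  by apply/seteqP; split=> u; [case=> u0 uN u1|case=> -[u0 uN] u1]; split=> //;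
    [split=> // x _; exact: u0|move=> x; exact: u0].
apply: closedI; first apply: closedI.
- apply: closed_bigI => x _.
  apply: (@preimage_closed _ _ (fun u : {ptws X -> R} => u x) [set r | 0 <= r]).
    by move=> u _; exact: ptws_eval_continuous.
  exact: closed_ge.
- apply: closed_bigI => x _.
  apply: (@preimage_closed _ _ (fun u : {ptws X -> R} => u x) [set r | r = 0]).
    by move=> u _; exact: ptws_eval_continuous.
  exact: closed_eq.
apply: (@preimage_closed _ _ (fun u : {ptws X -> R} => \sum_(x <- s) u x)
  [set r | r = 1]); last exact: closed_eq.
move=> u _; apply: (@cvg_big R X +%R 0 xpredT (@add_continuous R)
    {ptws X -> R} (nbhs u) s (fun x u => u x)) => x _.
exact: ptws_eval_continuous.
Qed.

(** The point t may lie outside the simplex s; closed simplices being closed for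
pointwise convergence, the conclusion is then vacuous near t.  This is what
allows several simplices to be treated simultaneously, by intersecting finitely
many neighbourhoods. *)
Lemma near_simplex U t s : open U -> U t -> sorted <%O s ->
  \forall u \near (bary t : {ptws X -> R}),
    forall v : realization R X, bary v = u -> in_simplex s v -> U v.
Proof.
rewrite realization_openE => oU Ut ss.
have [ts|ts] := pselect (in_simplex s t); last first.
  have oC := closed_openC (@simplex_closed s).
  apply: filterS (open_nbhs_nbhs (conj oC ts)) => u nu v vu.
  by rewrite vu => /nu.
have [V [oV UV]] := oU s ss.
have Vt : V (bary t).
  have : ([eta @bary R d X] @^-1` V `&` closed_simplex s) t by rewrite -UV.
  by case.
apply: filterS (open_nbhs_nbhs (conj oV Vt)) => u Vu v vu vs.
have : (U `&` closed_simplex s) v by rewrite UV; split=> //; rewrite /preimage /= vu.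
by case.
Qed.

(** Unlike in the definition of the weak topology, the open set of coordinate
functions may depend on the point: interiors glue the local witnesses. *)
Lemma realization_openP U :
  (forall s t, sorted <%O s -> U t -> in_simplex s t ->
     \forall u \near (bary t : {ptws X -> R}),
       forall v : realization R X, bary v = u -> in_simplex s v -> U v) ->
  open U.
Proof.
move=> nU; rewrite realization_openE => s ss.
pose V := [set u : {ptws X -> R} |
  forall v : realization R X, bary v = u -> in_simplex s v -> U v].
exists V°; split; first exact: open_interior.
apply/seteqP; split=> t [Ut st]; split=> //; first exact: nU.
by apply: (interior_subset Ut).
Qed.

End Coherent.

(** The product of the weak topology with the locally compact space R is again
determined by the closed simplices.  If h (r, t) is in the open set U, then
h (x, t) is in U for all x in a compact interval J around r; the v such that
h (x, v) is in U for all x in J form a weakly open set, since by compactness of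
J this can be tested near one point of one simplex at a time. *)
Lemma cylinder_continuous (R : realType) d (X : porderType d) (Y : topologicalType)
    (h : R * realization R X -> Y) :
  (forall (U : set Y) (s : seq X) (r : R) (t : realization R X),
     open U -> sorted <%O s -> in_simplex s t -> U (h (r, t)) ->
     \forall q \near (r, bary t : {ptws X -> R}),
       forall v : realization R X, bary v = q.2 -> in_simplex s v -> U (h (q.1, v))) ->
  continuous h.
Proof.
move=> hU [r t] W /=; rewrite nbhsE => -[U [oU Urt] UW].
have [s [ss st]] := baryP t.
have [[A B] /= [Ar Bt] AB] := hU U s r t oU ss st Urt.
have /nbhs_ballP[e /= e0 eA] := Ar.
pose J : set R := [set` `[r - e / 2, r + e / 2]].
have JA : J `<=` A.
  move=> x; rewrite /J /= in_itv /= => /andP[x1 x2]; apply: eA.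
  rewrite /ball /= ltr_distlC; lra.
have Jr : nbhs r J.
  apply/nbhs_ballP; exists (e / 2); first by rewrite /= divr_gt0.
  by move=> x; rewrite /ball /= ltr_distlC /J /= in_itv /= => /andP[/ltW-> /ltW->].
pose T := [set v | forall x, J x -> U (h (x, v))].
have oT : open T.
  apply: realization_openP => s' v ss' Tv vs'.
  have /compact_near_coveringP cJ : compact J := @segment_compact _ _ _.
  pose P (u : {ptws X -> R}) (x : R) := forall w : realization R X,
    bary w = u -> in_simplex s' w -> U (h (x, w)).
  have nJ : \forall u \near (bary v : {ptws X -> R}), J `<=` P u.
    by apply: (cJ _ _ P (nbhs_filter (bary v : {ptws X -> R}))) => x Jx;
      exact: (hU U s' x v oU ss' vs' (Tv x Jx)).
  have PT (u : {ptws X -> R}) : J `<=` P u ->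
      forall w : realization R X, bary w = u -> in_simplex s' w -> T w.
    by move=> uJ w wu ws x /uJ; exact.
  exact: filterS PT nJ.
have Tt : T t.
  move=> x /JA Ax; have /= := AB (x, bary t); apply=> //.
  split=> //; exact: (@nbhs_singleton {ptws X -> R} (bary t) B Bt).
exists (J, T); first by split=> //; exact: open_nbhs_nbhs.
by move=> [x v] [/= Jx Tv]; apply: UW; exact: Tv.
Qed.

(** * Lifting a realization to the prism over a poset *)

Section Chains.
Variables (d : Order.disp_t) (X : porderType d).
Implicit Types (s : seq X) (x y m : X).

Lemma sorted_comparable s x y : sorted <%O s -> x \in s -> y \in s ->
  (x <= y)%O || (y < x)%O.
Proof.
move=> ss xs ys; have [xy|yx|xy] := ltngtP (index x s) (index y s).
- by rewrite ltW // (sorted_ltn_index lt_trans ss _ _ xs ys xy).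
- by rewrite (sorted_ltn_index lt_trans ss _ _ ys xs yx) orbT.
- by rewrite -(nth_index x xs) xy nth_index // lexx.
Qed.

(** In the application P is upward closed along s, and m is the first element
satisfying it, or the last element of s if there is none. *)
Lemma sorted_pivot (P : pred X) s : sorted <%O s -> s != [::] ->
  exists2 m, m \in s & forall x, x \in s ->
    ((x < m)%O -> ~~ P x) /\ ((m < x)%O -> P m).
Proof.
elim: s => // x s IHs xs _.
have xlt y : y \in s -> (x < y)%O.
  by move: xs; rewrite /= (path_sortedE lt_trans) => /andP[/allP + _]; apply.
have [/orP Px|] := boolP (P x || (s == [::])).
  exists x; first exact: mem_head.
  move=> y; rewrite inE => /predU1P[->|ys]; first by rewrite ltxx.
  rewrite lt_gtF ?xlt //; split=> // _; case: Px => // /eqP s0.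
  by rewrite s0 in ys.
rewrite negb_or => /andP[nPx s0].
have [m ms mP] := IHs (path_sorted xs) s0.
exists m; first by rewrite inE ms orbT.
move=> y; rewrite inE => /predU1P[->|/mP//]; split=> // mx.
by have := lt_trans mx (xlt _ ms); rewrite ltxx.
Qed.

(** The maximal simplex of the triangulated prism over the chain s whose vertical
edge lies over m. *)
Definition prism m s : seq (X *p bool) :=
  [seq (x, false) | x <- s & (x <= m)%O] ++ [seq (x, true) | x <- s & (m <= x)%O].

Lemma prism_sorted m s : sorted <%O s -> sorted <%O (prism m s).
Proof.
rewrite !(sorted_pairwise lt_trans) => ss; rewrite pairwise_cat !pairwise_map.
apply/and3P; split.
- apply/allrelP => _ _ /mapP[x + ->] /mapP[y + ->].
  rewrite !mem_filter => /andP[xm _] /andP[my _].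
  by rewrite lt_def Order.ProdOrder.leEprod /= (le_trans xm my) andbT xpair_eqE andbF.
- apply: sub_pairwise (pairwise_filter _ ss) => x y xy.
  by rewrite /= lt_def Order.ProdOrder.leEprod /= xpair_eqE andbT (ltW xy) gt_eqF.
- apply: sub_pairwise (pairwise_filter _ ss) => x y xy.
  by rewrite /= lt_def Order.ProdOrder.leEprod /= xpair_eqE andbT (ltW xy) gt_eqF.
Qed.

End Chains.

Section Lift.
Variables (R : realType) (d : Order.disp_t) (X : porderType d).
Implicit Types (s : seq X) (t : X -> R) (r : R) (x y m : X).

Definition mass_below t x : R := \sum_(y \in [set y | (y < x)%O]) t y.

(** The mass at x occupies the interval from mass_below t x to
mass_below t x + t x; this is the length of its part below 1 - r.  It lies
between 0 and t x for every real r, so that the lift to the prism is defined and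
continuous on all of R and not only on the unit interval. *)
Definition unmoved r t x : R :=
  Num.min (mass_below t x + t x) (1 - r) - Num.min (mass_below t x) (1 - r).

Definition prism_bary r t (z : X *p bool) : R :=
  if z.2 then t z.1 - unmoved r t z.1 else unmoved r t z.1.

Lemma mass_belowE s t x : uniq s -> in_simplex s t ->
  mass_below t x = \sum_(y <- s | (y < x)%O) t y.
Proof. by move=> us [_ ts _]; rewrite bigfs // => y _; exact: ts. Qed.

Lemma mass_below_lt s t x y : uniq s -> in_simplex s t -> x \in s -> (x < y)%O ->
  mass_below t x + t x <= mass_below t y.
Proof.
move=> us ts xs xy; have [t0 _ _] := ts; rewrite !(mass_belowE _ us ts).
rewrite [leRHS]big_mkcond [leRHS](bigD1_seq x) //= xy [leLHS]addrC lerD2l.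
rewrite big_mkcond [leRHS]big_mkcond /=; apply: ler_sum => z _.
case: ifP => [zx|_]; last by do ?case: ifP => //.
by rewrite (lt_trans zx xy) lt_eqF.
Qed.

Lemma mass_below_le1 s t x : uniq s -> in_simplex s t ->
  mass_below t x + t x <= 1.
Proof.
move=> us ts; have [t0 tN t1] := ts; rewrite (mass_belowE _ us ts) -t1.
have [xs|xs] := boolP (x \in s); last first.
  rewrite tN // addr0 big_mkcond; apply: ler_sum => z _.
  by case: ifP.
rewrite [leRHS](bigD1_seq x) //= [leLHS]addrC lerD2l.
rewrite big_mkcond [leRHS]big_mkcond /=; apply: ler_sum => z _.
case: ifP => [zx|_]; last by case: ifP.
by rewrite lt_eqF.
Qed.

Lemma unmoved_bounds r t x : 0 <= t x -> 0 <= unmoved r t x <= t x.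
Proof.
rewrite /unmoved => tx0.
by case: (leP (_ + _) (1 - r)) => ?; case: (leP (mass_below _ _) (1 - r)) => ?;
  apply/andP; split; lra.
Qed.

Lemma unmoved_out r t x : t x = 0 -> unmoved r t x = 0.
Proof. by rewrite /unmoved => ->; rewrite addr0 subrr. Qed.

(** The pivot m is where the cumulative mass reaches 1 - r: all mass strictly
below m stays on the bottom level and all mass strictly above m moves up. *)
Lemma prism_bary_simplex r s t : sorted <%O s -> in_simplex s t ->
  exists2 m, m \in s & in_simplex (prism m s) (prism_bary r t).
Proof.
move=> ss st; have us := lt_sorted_uniq ss; have [t0 tN t1] := st.
have s0 : s != [::].
  by apply: contra_eq_neq t1 => ->; rewrite big_nil eq_sym oner_eq0.
have [m ms mP] :=
  sorted_pivot (fun x => 1 - r <= mass_below t x + t x) ss s0.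
have low x : x \in s -> ~~ (x <= m)%O -> unmoved r t x = 0.
  move=> xs xm; have mx : (m < x)%O.
    by have := sorted_comparable ss xs ms; rewrite (negPf xm).
  have := (mP x xs).2 mx; have := mass_below_lt us st ms mx; have := t0 x.
  by rewrite /unmoved; case: (leP (_ + _) (1 - r)) => ?;
    case: (leP (mass_below _ _) (1 - r)) => ?; lra.
have up x : x \in s -> ~~ (m <= x)%O -> unmoved r t x = t x.
  move=> xs mx; have xm : (x < m)%O.
    by have := sorted_comparable ss ms xs; rewrite (negPf mx).
  have := (mP x xs).1 xm; rewrite -ltNge; have := t0 x.
  by rewrite /unmoved; case: (leP (_ + _) (1 - r)) => ?;
    case: (leP (mass_below _ _) (1 - r)) => ?; lra.
exists m => //; split=> [[x c]|[x c]|].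
- have /andP[] := @unmoved_bounds r t x (t0 x).
  by rewrite /prism_bary; case: c => /=; lra.
- have [xs|xs] := boolP (x \in s); last first.
    by rewrite /prism_bary /= unmoved_out ?tN ?subrr ?if_same.
  rewrite mem_cat negb_or => /andP[xm mx]; rewrite /prism_bary /=.
  case: c xm mx => xm mx.
    rewrite up ?subrr //; apply: contra mx => mx.
    by rewrite map_f // mem_filter mx.
  rewrite low //; apply: contra xm => xm.
  by rewrite map_f // mem_filter xm.
rewrite big_cat /= !big_map !big_filter /prism_bary /= -t1.
rewrite [X in X + _]big_mkcond [X in _ + X]big_mkcond -big_split /=.
apply: eq_big_seq => x xs.
have := up x xs; have := low x xs.
case: (x <= m)%O => [_|/(_ isT) lo]; case: (m <= x)%O => [_|/(_ isT) hi]; lra.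
Qed.

Fact prism_bary_realization r (t : realization R X) :
  exists s : seq (X *p bool), sorted <%O s /\ in_simplex s (prism_bary r t).
Proof.
have [s [ss st]] := baryP t; have [m _ mt] := prism_bary_simplex r ss st.
by exists (prism m s); split=> //; exact: prism_sorted.
Qed.

Definition to_prism (q : R * realization R X) : realization R (X *p bool) :=
  Realization (prism_bary_realization q.1 q.2).

Lemma to_prism_continuous : continuous to_prism.
Proof.
apply: cylinder_continuous => U s r t oU ss st Urt; have us := lt_sorted_uniq ss.
(* On the simplex s the lift is the restriction of a map F between spaces of
   functions, in which the mass below x is a fixed finite sum. *)
pose M (x : X) (q : R * {ptws X -> R}) : R := \sum_(y <- s | (y < x)%O) q.2 y.
pose L (x : X) (q : R * {ptws X -> R}) : R :=
  Num.min (M x q + q.2 x) (1 - q.1) - Num.min (M x q) (1 - q.1).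
pose F (q : R * {ptws X -> R}) : {ptws (X *p bool) -> R} :=
  fun z => if z.2 then q.2 z.1 - L z.1 q else L z.1 q.
have ev x : continuous (fun q : R * {ptws X -> R} => q.2 x).
  move=> q; apply: (@continuous_comp _ _ _ snd (fun u : {ptws X -> R} => u x)).
    exact: cvg_snd.
  exact: ptws_eval_continuous.
have sub_c (T : topologicalType) (f g : T -> R) : continuous f -> continuous g ->
    continuous (fun q => f q - g q).
  by move=> fc gc q; exact: (@cvgB R R^o _ (nbhs q) _ f g _ _ (fc q) (gc q)).
have min_c (T : topologicalType) (f g : T -> R) : continuous f -> continuous g ->
    continuous (fun q => Num.min (f q) (g q)).
  by move=> fc gc q; exact: (@continuous_min R _ f g q (fc q) (gc q)).
have sc (T : topologicalType) : continuous (fun q : R * T => 1 - q.1).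
  apply: (sub_c _ (fun=> 1) fst) => q; first exact: cvg_cst.
  exact: cvg_fst.
have Mc x : continuous (M x).
  move=> q; apply: (@cvg_big R X +%R 0 (fun y => (y < x)%O) (@add_continuous R)
    _ (nbhs q) s (fun y q => q.2 y)) => y _.
  exact: ev.
have Mxc x : continuous (fun q => M x q + q.2 x).
  move=> q; exact: (@cvgD R R^o _ (nbhs q) _ (M x) (fun q => q.2 x) _ _
    (Mc x q) (ev x q)).
have Lc x : continuous (L x).
  exact: (sub_c _ _ _ (min_c _ _ _ (Mxc x) (@sc _)) (min_c _ _ _ (Mc x) (@sc _))).
have Fc : continuous F.
  apply: ptws_continuous => -[x []]; last exact: (Lc x).
  exact: (sub_c _ _ _ (ev x) (Lc x)).
have FE r' (v : realization R X) :
    in_simplex s v -> bary (to_prism (r', v)) = F (r', bary v).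
  move=> sv; apply/funext => -[x c].
  by rewrite /= /prism_bary /F /L /M /unmoved (mass_belowE _ us sv).
(* The image of the simplex s is covered by the simplices of the prism that have
   their vertical edge over an element of s. *)
pose W (i : 'I_(size s)) (u : {ptws (X *p bool) -> R}) :=
  forall v, bary v = u -> in_simplex (prism (tnth (in_tuple s) i) s) v -> U v.
have nW : \forall u \near F (r, bary t), forall i, W i u.
  apply: (@filter_forall _ _ W _ (nbhs_filter (F (r, bary t)))) => i.
  by rewrite -FE //; apply: near_simplex => //; exact: prism_sorted.
have FU (q : R * {ptws X -> R}) : (forall i, W i (F q)) ->
    forall v : realization R X, bary v = q.2 -> in_simplex s v ->
      U (to_prism (q.1, v)).
  case: q => r' u /= Fu v vu sv.
  have [m ms mv] := prism_bary_simplex r' ss sv.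
  have im : (index m s < size s)%N by rewrite index_mem.
  apply: (Fu (Ordinal im)); first by rewrite FE // vu.
  by rewrite (tnth_nth m) /= nth_index.
have nF : nbhs ((r, bary t) : R * {ptws X -> R}) (F @^-1` [set u | forall i, W i u]).
  exact: (Fc _ _ nW).
exact: (@filterS _ (nbhs ((r, bary t) : R * {ptws X -> R})) _ _ _ FU nF).
Qed.

End Lift.

(** * Comparable equivariant maps are homotopic *)

Section Push.
Variables (R : realType) (d d' : Order.disp_t).
Variables (X : porderType d) (Y : porderType d') (f : X -> Y).

Lemma push_inj (t : X -> R) x : injective f -> push f t (f x) = t x.
Proof.
move=> fI; rewrite /push (_ : f @^-1` [set f x] = [set x]) ?fsbig_set1 //.
by apply/seteqP; split=> y /= => [/fI|->].
Qed.

Lemma push_out (t : X -> R) y : (forall x, f x != y) -> push f t y = 0.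
Proof.
move=> fy; rewrite /push (_ : f @^-1` [set y] = set0) ?fsbig_set0 //.
by apply/seteqP; split=> x //= /eqP; rewrite (negPf (fy x)).
Qed.

End Push.

Section Ends.
Variables (R : realType) (d : Order.disp_t) (X : porderType d).

Definition prism_end (c : bool) (x : X) : X *p bool := (x, c).

Lemma prism_end_le c : {homo prism_end c : x y / (x <= y)%O}.
Proof. by move=> x y xy; rewrite Order.ProdOrder.leEprod /= xy lexx. Qed.

Lemma prism_end_inj c : injective (prism_end c).
Proof. by move=> x y []. Qed.

Lemma to_prism0 (t : realization R X) :
  to_prism (0, t) = realize (@prism_end_le false) t.
Proof.
have [s [ss st]] := baryP t; have us := lt_sorted_uniq ss; have [t0 _ _] := st.
have tE x : unmoved 0 t x = t x.
  have := mass_below_le1 x us st; have := t0 x; rewrite /unmoved subr0.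
  by move=> ? ?; rewrite !min_l; lra.
apply: realizationP => -[x []] /=; rewrite /prism_bary /= tE.
  by rewrite subrr push_out // => y; rewrite xpair_eqE andbF.
by rewrite (@push_inj R _ _ _ _ (prism_end false)) //; exact: prism_end_inj.
Qed.

Lemma to_prism1 (t : realization R X) :
  to_prism (1, t) = realize (@prism_end_le true) t.
Proof.
have [s [ss st]] := baryP t; have us := lt_sorted_uniq ss; have [t0 _ _] := st.
have tE x : unmoved 1 t x = 0.
  have b0 : 0 <= mass_below t x by rewrite (mass_belowE _ us st) sumr_ge0.
  by have := t0 x; rewrite /unmoved subrr => ?; rewrite !min_r ?subrr //; lra.
apply: realizationP => -[x []] /=; rewrite /prism_bary /= tE.
  rewrite subr0 (@push_inj R _ _ _ _ (prism_end true)) //; exact: prism_end_inj.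
by rewrite push_out // => y; rewrite xpair_eqE andbF.
Qed.

Variables (d' : Order.disp_t) (Y : porderType d') (f : X -> Y).

Definition prism_map (z : X *p bool) : Y *p bool := (f z.1, z.2).

Lemma prism_map_le : {homo f : x y / (x <= y)%O} ->
  {homo prism_map : x y / (x <= y)%O}.
Proof.
move=> f_le z w; rewrite !Order.ProdOrder.leEprod /= => /andP[zw ->].
by rewrite f_le.
Qed.

(** An order isomorphism preserves the cumulative mass, hence the cut. *)
Lemma to_prism_iso (f_le : {homo f : x y / (x <= y)%O}) r (t : realization R X) :
  bijective f -> {mono f : x y / (x <= y)%O} ->
  to_prism (r, realize f_le t) = realize (prism_map_le f_le) (to_prism (r, t)).
Proof.
move=> [g fK gK] fm; have fI := can_inj fK.
have [s [ss st]] := baryP t; have us := lt_sorted_uniq ss.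
have bE x : mass_below (realize f_le t) (f x) = mass_below t x.
  rewrite (mass_belowE _ _ (push_simplex f us st)) ?undup_uniq //.
  rewrite undup_id ?map_inj_uniq // big_map (mass_belowE _ us st).
  apply: eq_big => [y|y _]; last exact: push_inj.
  by rewrite !lt_leAnge !fm.
apply: realizationP => -[y c]; rewrite -[y]gK.
have -> : (f (g y), c) = prism_map (g y, c) by [].
rewrite [RHS](@push_inj R _ _ _ _ prism_map); last first.
  by move=> [x1 c1] [x2 c2] [/fI-> ->].
by rewrite /= /prism_bary /unmoved /= bE push_inj.
Qed.

End Ends.

Section OrderHomotopy.
Variables (R : realType) (G : finGroupType) (X Y : gposet G).

Lemma gposet_act_bij (g : G) : bijective ((gposet_act X)^~ g).
Proof.
by exists ((gposet_act X)^~ g^-1%g) => x;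
  rewrite -total_actM ?mulgV ?mulVg total_act1.
Qed.

Lemma gposet_act_mono (g : G) : {mono (gposet_act X)^~ g : x y / (x <= y)%O}.
Proof.
move=> x y; apply/idP/idP => [xy|]; last exact: gposet_act_le.
rewrite -[x](total_act1 (gposet_act X)) -[y](total_act1 (gposet_act X)).
by rewrite -(mulgV g) !total_actM gposet_act_le.
Qed.

Variables (f g : X -> Y).
Hypotheses (f_le : {homo f : x y / (x <= y)%O}) (g_le : {homo g : x y / (x <= y)%O}).
Hypotheses (fE : equivariant (gposet_act X) (gposet_act Y) f)
  (gE : equivariant (gposet_act X) (gposet_act Y) g).
Hypothesis fg : forall x, (f x <= g x)%O.

Let F (z : X *p bool) : Y := if z.2 then g z.1 else f z.1.

(* The only case that involves both maps is f x <= g x <= g y. *)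
Let F_le : {homo F : z w / (z <= w)%O}.
Proof.
move=> [x b] [y c]; rewrite Order.ProdOrder.leEprod /F /= => /andP[xy].
case: b c => [] [] // _; [exact: g_le| |exact: f_le].
exact: le_trans (fg x) (g_le xy).
Qed.

(** The values at times 0 and 1 are computed by restricting F to the two ends of
the prism. *)
Theorem order_homotopy :
  @G_homotopic G R (order_complex R X) (order_complex R Y)
    (realize f_le) (realize g_le).
Proof.
exists (realize F_le \o @to_prism R _ X); split=> [|r t a _|t|t].
- apply: continuous_subspaceT => q.
  by apply: continuous_comp; [exact: to_prism_continuous|exact: realize_continuous].
- rewrite /= /realization_act to_prism_iso;
    [|exact: gposet_act_bij|exact: gposet_act_mono].
  have h_le : {homo (fun z => gposet_act Y (F z) a) : z w / (z <= w)%O}.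
    by move=> z w zw; apply/gposet_act_le/F_le.
  rewrite -(realize_comp (prism_map_le _) F_le h_le) -?(realize_comp F_le _ h_le) //.
  by move=> [x c]; rewrite /F /=; case: c; rewrite ?fE ?gE.
- by rewrite /= to_prism0 -(realize_comp (prism_end_le false) F_le f_le).
- by rewrite /= to_prism1 -(realize_comp (prism_end_le true) F_le g_le).
Qed.

End OrderHomotopy.

(** Both composites lie above the identity, so the order homotopy theorem applies
to each of them, compared with the identity. *)
Lemma order_inverse_equivalences (R : realType) (G : finGroupType) (X Y : gposet G)
    (f : X -> Y) (g : Y -> X) :
  {homo f : x y / (x <= y)%O} -> {homo g : x y / (x <= y)%O} ->
  equivariant (gposet_act X) (gposet_act Y) f ->
  equivariant (gposet_act Y) (gposet_act X) g ->
  (forall x, x <= g (f x))%O -> (forall y, y <= f (g y))%O ->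
  inverse_G_poset_equivalences R f g.
Proof.
have unit_homotopy (Z W : gposet G) (u : Z -> W) (v : W -> Z)
    (u_le : {homo u : x y / (x <= y)%O}) (v_le : {homo v : x y / (x <= y)%O}) :
    equivariant (gposet_act Z) (gposet_act W) u ->
    equivariant (gposet_act W) (gposet_act Z) v ->
    (forall z, z <= v (u z))%O ->
    @G_homotopic G R (order_complex R Z) (order_complex R Z)
      id (realize v_le \o realize u_le).
  move=> uE vE uv.
  have id_le : {homo (@id Z) : x y / (x <= y)%O} by [].
  have vu_le : {homo v \o u : x y / (x <= y)%O} by move=> x y /u_le/v_le.
  have vuE : equivariant (gposet_act Z) (gposet_act Z) (v \o u).
    by move=> x a; rewrite /= uE vE.
  have idE : equivariant (gposet_act Z) (gposet_act Z) id by [].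
  have [h [hc hE h0 h1]] := @order_homotopy R G Z Z _ _ id_le vu_le idE vuE uv.
  exists h; split=> // z; first by rewrite h0 realize_id.
  by rewrite h1; exact: realize_comp.
have realize_equivariant (Z W : gposet G) (u : Z -> W)
    (u_le : {homo u : x y / (x <= y)%O}) :
    equivariant (gposet_act Z) (gposet_act W) u ->
    @equivariant G (realization R Z) (realization R W)
      (gspace_act (order_complex R Z)) (gspace_act (order_complex R W))
      (realize u_le).
  move=> uE t a; rewrite /= /realization_act.
  have ua_le : {homo (fun z => u (gposet_act Z z a)) : x y / (x <= y)%O}.
    by move=> x y xy; apply/u_le/gposet_act_le.
  rewrite -(realize_comp (@gposet_act_le G Z a) u_le ua_le) //.
  by rewrite -(realize_comp u_le (@gposet_act_le G W a) ua_le).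
move=> f_le g_le fE gE gf fg; exists f_le, g_le; split=> //; split.
- by split; [exact: realize_continuous|exact: realize_equivariant].
- by split; [exact: realize_continuous|exact: realize_equivariant].
- exact: unit_homotopy.
- exact: unit_homotopy.
Qed.

(** * The commuting poset of a block *)

Local Close Scope classical_set_scope.

Section CommutingPoset.
Variables (k : fieldType) (p : nat) (G : finGroupType) (b : block k [set: G]%G).

Lemma subgroups_of_order_pJ (Q : {group G}) g :
  subgroups_of_order_p p (Q :^ g)%G =
  [set (H :^ g)%G | H in subgroups_of_order_p p Q].
Proof.
apply/setP => H; apply/idP/imsetP => [|[K]].
  rewrite inE /= => /andP[HQ Hp]; exists (H :^ g^-1)%G.
    by rewrite inE /= cardJg Hp sub_conjg invgK HQ.
  by apply: val_inj; rewrite /= conjsgKV.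
by rewrite !inE => /andP[KQ Kp] ->; rewrite /= conjSg KQ cardJg.
Qed.

Lemma cp_brauer_Phi (x : elab_pair p b) : cp_brauer (Phi x) = elab_val x.
Proof.
have /andP[_ xp] := elab_valP x.
by apply: val_inj; rewrite /= pi_group_order_p // -surjective_pairing.
Qed.

Lemma Phi_le : {homo (@Phi k G p b : elab_poset p b -> comm_poset p b) :
  x y / (x <= y)%O}.
Proof.
move=> x y xy; apply/andP; split; last by rewrite !cp_brauer_Phi.
apply/fintype.subsetP => H; rewrite !inE => /andP[Hx ->].
by rewrite (fintype.subset_trans Hx) ?(bp_sub xy).
Qed.

Lemma Phi_equivariant : equivariant (gposet_act (elab_poset p b))
  (gposet_act (comm_poset p b)) (@Phi k G p b).
Proof. by move=> x g; apply: val_inj; rewrite /= subgroups_of_order_pJ. Qed.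

Variable charkp : p \in [pchar k].

Lemma Psi_le : {homo (Psi charkp : comm_poset p b -> elab_poset p b) :
  x y / (x <= y)%O}.
Proof. by move=> x y /andP[]. Qed.

Lemma Psi_equivariant : equivariant (gposet_act (comm_poset p b))
  (gposet_act (elab_poset p b)) (Psi charkp).
Proof. by move=> x g; do 2 apply: val_inj; rewrite /= pi_groupJ. Qed.

Lemma PhiK : cancel (@Phi k G p b) (Psi charkp).
Proof. by move=> x; apply: val_inj; exact: cp_brauer_Phi. Qed.

Lemma le_Phi_Psi (x : comm_poset p b) : (x <= Phi (Psi charkp x))%O.
Proof.
apply/andP; split; last by rewrite cp_brauer_Phi.
apply/fintype.subsetP => H Hx; rewrite inE pi_group_sub //=.
by have [_ xp _ _] := comm_pairP x; rewrite xp.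
Qed.

End CommutingPoset.

Theorem theorem2 (R : realType) (k : fieldType) (p : nat)
    (charkp : p \in [pchar k]) (G : finGroupType) (b : block k [set: G]%G) :
  inverse_G_poset_equivalences R
    (@Phi k G p b : elab_poset p b -> comm_poset p b)
    (@Psi k G p b charkp : comm_poset p b -> elab_poset p b).
Proof.
apply: order_inverse_equivalences.
- exact: Phi_le.
- exact: Psi_le.
- exact: Phi_equivariant.
- exact: Psi_equivariant.
- by move=> x; rewrite PhiK.
- exact: le_Phi_Psi.
Qed.
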